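(* Let $B_1=B_1(0)$ be the unit ball in $\mathbb{R}^d$, let $\alpha\in(0,2)$ and $\nu(h)=|h|^{-d-\alpha}$, and let $\widetilde\nu(h)=(1+|h|)^{-d-\alpha}$. There exists $g\in L^1(B_1^c)\setminus L^2(B_1^c,\widetilde\nu^{-1})$ with $\int_{B_1^c}g(y)\,dy=0$ for which the Neumann problem $Lu=0$ in $B_1$, $\mathcal{N}u=g$ on $\mathbb{R}^d\setminus B_1$ has no weak solution in $V_\nu(B_1|\mathbb{R}^d)$, i.e. there is no $u\in V_\nu(B_1|\mathbb{R}^d)$ with $$\mathcal{E}(u,v)=\int_{B_1^c}g(y)v(y)\,dy\qquad\text{for all }v\in V_\nu(B_1|\mathbb{R}^d).$$
   Context: With $\Omega=B_1$: $V_\nu(\Omega|\mathbb{R}^d)$ is the space of measurable $u:\mathbb{R}^d\to\mathbb{R}$ with $u|_\Omega\in L^2(\Omega)$ and $\int_\Omega\int_{\mathbb{R}^d}(u(x)-u(y))^2\nu(x-y)\,dy\,dx<\infty$; $\mathcal{E}(u,v)=\frac12\iint_{(\Omega^c\times\Omega^c)^c}(u(x)-u(y))(v(x)-v(y))\nu(x-y)\,dx\,dy$; $Lu(x)=\mathrm{p.v.}\int_{\mathbb{R}^d}(u(x)-u(y))\nu(x-y)\,dy$; $\mathcal{N}u(y)=\int_\Omega(u(y)-u(x))\nu(x-y)\,dx$ for $y\in\Omega^c$. $L^2(B_1^c,\widetilde\nu^{-1})$ is the $L^2$-space for the measure $\widetilde\nu(x)^{-1}dx=(1+|x|)^{d+\alpha}dx$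 on $B_1^c$. Being a weak solution includes the requirement that the integral $\int_{B_1^c}g\,v\,dy$ exists for every $v\in V_\nu(B_1|\mathbb{R}^d)$. *)

(* Defs.v *)
From HB Require Import structures.
From mathcomp Require Import all_boot all_order all_algebra.
From mathcomp Require Import all_classical all_reals all_analysis.
Set Implicit Arguments.
Unset Strict Implicit.
Unset Printing Implicit Defensive.
Import Order.TTheory GRing.Theory Num.Theory.
Import numFieldNormedType.Exports.
Local Open Scope classical_set_scope.
Local Open Scope ring_scope.

(* R^d is [d.-tuple R] with its product (Borel) sigma-algebra.  MathComp-Analysis
   has no Lebesgue measure on it, so it is built here by iterating the binary
   product with the one-dimensional Lebesgue measure; [leb_box] gives its value
   on boxes, which determines it. *)
Section lebesgue_tuple.
Context {R : realType}.
Local Open Scope ereal_scope.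

Definition tcons (n : nat) (z : measurableTypeR R * n.-tuple R) :
  n.+1.-tuple R := [the n.+1.-tuple R of z.1 :: z.2].

Lemma measurable_tcons (n : nat) : measurable_fun [set: _] (@tcons n).
Proof.
have h1 : measurable_fun [set: measurableTypeR R * n.-tuple R]
    (fun z => z.1 : R).
  by move=> _ Y mY; exact: (@measurable_fst _ _ (measurableTypeR R)
    (n.-tuple R) measurableT Y mY).
by apply: (measurable_cons h1); exact: measurable_snd.
Qed.

Definition uncons (n : nat) (x : n.+1.-tuple R) :
  measurableTypeR R * n.-tuple R := (thead x, [tuple of behead x]).

Lemma measurable_uncons (n : nat) : measurable_fun [set: _] (@uncons n).
Proof.
apply: measurable_fun_pair; last exact: measurable_behead.
by move=> _ Y mY; exact: (@measurable_tnth _ R n.+1 ord0 measurableT Y mY).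
Qed.

Lemma tconsK (n : nat) : cancel (@tcons n) (@uncons n).
Proof.
by move=> [a t]; rewrite /uncons /tcons/= theadE; congr pair; exact/val_inj.
Qed.

(* HB does not find the sigma-finiteness of [\x] for general factors, hence the
   direct proof of [leb_step_sigma_finite]. *)
Section step.
Context (n : nat) (mu : {sigma_finite_measure set (n.-tuple R) -> \bar R}).

Definition leb_step : set (n.+1.-tuple R) -> \bar R :=
  pushforward (@lebesgue_measure R \x mu) (@tcons n).

Let leb_step0 : leb_step set0 = 0.
Proof. by rewrite /leb_step /pushforward preimage_set0 measure0. Qed.

Let leb_step_ge0 A : 0 <= leb_step A.
Proof. by rewrite /leb_step /pushforward; exact: measure_ge0. Qed.

Let leb_step_sigma_additive : semi_sigma_additive leb_step.
Proof.
exact: (@measure_semi_sigma_additive _ _ _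
  (measure_function_pushforward__canonical__measure_function_Measure
     (@lebesgue_measure R \x mu) (@measurable_tcons n))).
Qed.

HB.instance Definition _ := isMeasure.Build _ _ _ leb_step
  leb_step0 leb_step_ge0 leb_step_sigma_additive.

Let leb_step_sigma_finite : sigma_finite setT leb_step.
Proof.
have /sigma_finiteP[F [TF ndF Foo]] := sigma_finiteT (@lebesgue_measure R).
have /sigma_finiteP[G [TG ndG Goo]] := sigma_finiteT mu.
exists (fun k => @uncons n @^-1` (F k `*` G k)).
  rewrite -preimage_bigcup [X in _ @^-1` X](_ : _ = setT) ?preimage_setT//.
  rewrite -subTset => -[a t] _.
  have [i _ Fa] : (\bigcup_i F i) a by rewrite -TF.
  have [j _ Gt] : (\bigcup_i G i) t by rewrite -TG.
  exists (maxn i j) => //; split => /=.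
    by move: a Fa; exact/subsetPset/ndF/leq_maxl.
  by move: t Gt; exact/subsetPset/ndG/leq_maxr.
move=> k; have [mF Fk] := Foo k; have [mG Gk] := Goo k; split.
  rewrite -[X in measurable X]setTI; apply: measurable_uncons => //.
  exact: measurableX.
rewrite /leb_step /pushforward -comp_preimage.
rewrite (_ : @uncons n \o _ = id); last by apply/funext => z; exact: tconsK.
by rewrite preimage_id product_measure1E// lte_mul_pinfty// ge0_fin_numE.
Qed.

HB.instance Definition _ := Measure_isSigmaFinite.Build _ _ _ leb_step
  leb_step_sigma_finite.
End step.

Fixpoint leb (n : nat) : {sigma_finite_measure set (n.-tuple R) -> \bar R} :=
  match n with
  | 0 => \d_ ([tuple] : 0.-tuple R)
  | m.+1 => leb_step (leb m)
  end.

Lemma leb_box (n : nat) (A : 'I_n -> set R) :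
  (forall i, measurable (A i)) ->
  leb n [set x | forall i, A i (tnth x i)] =
  \prod_(i < n) @lebesgue_measure R (A i).
Proof.
elim: n A => [|n IH] A mA.
  rewrite big_ord0 /= diracE mem_set//. by case.
rewrite big_ord_recl -IH; last by move=> i; exact: mA.
rewrite -product_measure1E//=; [|exact: mA|]; last first.
  rewrite (_ : [set _ | _] = \bigcap_(i in [set: 'I_n])
      ((fun x => tnth x i) @^-1` A (lift ord0 i))).
    apply: fin_bigcap_measurable => // i _.
    rewrite -[X in measurable X]setTI; exact: measurable_tnth.
  by apply/seteqP; split => x /= h i; [move=> _|]; exact: h.
rewrite /leb_step /pushforward; congr (_ _); apply/seteqP; split => -[a t] /=.
  move=> h; split; first by have := h ord0.
  by move=> i; have := h (lift ord0 i); rewrite tnthS.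
move=> [ha ht] i; have [->//|i0] := eqVneq i ord0.
have [j ->] : exists j, i = lift ord0 j.
  by case: (unliftP ord0 i) i0 => [j ->|->]; [exists j|rewrite eqxx].
by rewrite tnthS.
Qed.
End lebesgue_tuple.

Section euclidean.
Context {R : realType} {d : nat}.
Implicit Types x y : d.-tuple R.

Definition vsub x y : d.-tuple R := [tuple tnth x i - tnth y i | i < d].

Definition enorm x : R := Num.sqrt (\sum_(i < d) tnth x i ^+ 2).

Definition unit_ball : set (d.-tuple R) := [set x | enorm x < 1].

(* [powR] sets [0 `^ a = 0] for [a != 0], so that [nu] vanishes at the origin;
   this affects no integral below, since [u x - u y = 0] when [x = y]. *)
Definition nu (alpha : R) x : R := enorm x `^ (- (d%:R + alpha)).

Definition nutilde (alpha : R) x : R := (1 + enorm x) `^ (- (d%:R + alpha)).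

(* [f] (restricted to [D]) is in the L^2-space over [D] of the measure
   [w(x) dx]. *)
Definition in_L2 (D : set (d.-tuple R)) (w f : d.-tuple R -> R) : Prop :=
  measurable_fun D f /\
  (\int[leb d]_(x in D) ((f x ^+ 2 * w x)%:E) < +oo)%E.

End euclidean.
Arguments unit_ball : clear implicits.

Section neumann_problem.
Context {R : realType} {d : nat}.
Variables (Omega : set (d.-tuple R)) (k : d.-tuple R -> R).
Implicit Types g u v : d.-tuple R -> R.

Definition V u : Prop :=
  [/\ measurable_fun [set: d.-tuple R] u,
      in_L2 Omega (fun=> 1) u &
      (\int[leb d]_(x in Omega) \int[leb d]_y
         (((u x - u y) ^+ 2 * k (vsub x y))%:E) < +oo)%E].

(* Extended-real valued, as the library's integral; the integrand is
   integrable for [u], [v] satisfying [V] (Cauchy-Schwarz). *)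
Definition energy u v : \bar R :=
  ((2^-1)%:E * \int[leb d \x leb d]_(z in ~` (~` Omega `*` ~` Omega))
     (((u z.1 - u z.2) * (v z.1 - v z.2) * k (vsub z.1 z.2))%:E))%E.

(* Weak solution of [L u = 0] in [Omega], [N u = g] on the complement of
   [Omega], where L is the nonlocal operator with kernel [k] and N the
   associated nonlocal normal derivative. *)
Definition weak_solution g u : Prop :=
  V u /\ forall v, V v ->
    (leb d).-integrable (~` Omega) (fun y => (g y * v y)%:E) /\
    energy u v = (\int[leb d]_(y in ~` Omega) (g y * v y)%:E)%E.

End neumann_problem.

(* Main.v *)
Require Import Defs.
From mathcomp Require Import all_boot all_order all_algebra.
From mathcomp Require Import all_classical all_reals all_analysis.
From mathcomp Require Import measurable_realfun lra.
Import Order.TTheory GRing.Theory Num.Theory.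
Import numFieldNormedType.Exports.
Local Open Scope classical_set_scope.
Local Open Scope ring_scope.

(** A weak solution [u] must in particular make [g * v] integrable over the
complement of the ball for every test function [v] in [V].  So it suffices to
produce a mean-zero integrable [g], outside the weighted L^2-space, and one
single [v] in [V] such that [g * v] is not integrable.

A function [v] that vanishes on the ball and lives at distance at least 1 from
it belongs to [V] as soon as [v ^+ 2] is integrable: the kernel is then bounded
by 1 between the ball and the support of [v], and the ball has finite measure
([V_slab_spike]).  Hence unboundedness of [v] at finite distance can be used,
in place of growth at infinity.  Take [v] equal to [4 ^+ n] on a set [A n] of
measure [32^-1 ^+ n], the sets [A n] being disjoint, and [v = 0] elsewhere.
Since [4 ^+ 2 < 32 < 4 ^+ 3], the integral of [v ^+ 2] is a convergent geometric
series, whereas the integral of [v ^+ 3] over [A n] is [2 ^+ n] and so unbounded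
in [n] ([integral_spike_sqr_lty], [integral_ge_spike_cube_pinfty]).

Let [g] be [v ^+ 2] minus a constant multiple of the indicator of a set of
measure 1, disjoint from the ball and from all the [A n], the constant being
chosen to make the integral vanish.  On the sets [A n] one has [g * v = v ^+ 3], and
[g ^+ 2] times the weight is at least [v ^+ 4 >= v ^+ 3], the weight being at
least 1.  Neither is integrable.

The sets [A n] are slabs, that is boxes whose sides are [[0, 1]] except in one
distinguished direction, so that their measure is the length of an interval. *)

(** * Monotonicity of the integral *)

(** The integral of a nonnegative function is a supremum over the simple
functions below it, hence is monotone for arbitrary functions.  This makes
comparison available for the inner integral in the seminorm of [V] without a
study of its measurability in the outer variable. *)
Lemma ge0_le_integral_any {dd} {T : measurableType dd} {R : realType}
    (mu : {measure set T -> \bar R}) (D : set T) (f1 f2 : T -> \bar R) :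
  (forall x, D x -> 0 <= f1 x)%E -> (forall x, D x -> f1 x <= f2 x)%E ->
  (\int[mu]_(x in D) f1 x <= \int[mu]_(x in D) f2 x)%E.
Proof.
move=> f10 f12.
have f20 x : D x -> (0 <= f2 x)%E.
  by move=> Dx; exact: le_trans (f10 _ Dx) (f12 _ Dx).
rewrite [leLHS]integral_mkcond [leRHS]integral_mkcond.
rewrite !ge0_integralTE; try exact: erestrict_ge0.
apply: ge_ereal_sup => _ [h /= hf1 <-]; apply: ereal_sup_ubound.
exists h => //= x; apply: le_trans (hf1 x) _; rewrite /patch.
by case: ifPn => // /set_mem; exact: f12.
Qed.

(** * A function in L^2 but not in L^3 *)

Section spikes.
Context {dd} {T : measurableType dd} {R : realType}.
Variables (mu : {measure set T -> \bar R}) (A : nat -> set T).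
Hypotheses (mA : forall n, measurable (A n)) (tA : trivIset setT A).
Hypothesis muA : forall n, mu (A n) = (32^-1 ^+ n)%:E.

(** On a disjoint family, [xget] returns the index of the only set that
contains the point. *)
Definition spike : T -> R :=
  (fun x => 4 ^+ xget 0%N [set n | A n x] : R) \_ (\bigcup_n A n).

Lemma spikeE n x : A n x -> spike x = 4 ^+ n.
Proof.
move=> Anx; rewrite /spike patchT; last by apply/mem_set; exists n.
congr (_ ^+ _); apply: (@xget_unique _ _ [set k | A k x]) => //= m Amx.
by apply: (tA m n) => //; exists x.
Qed.

Lemma spike_out x : ~ (\bigcup_n A n) x -> spike x = 0.
Proof. by move=> Ax; rewrite /spike patchN//; apply/negP => /set_mem. Qed.

Lemma spike_ge0 x : 0 <= spike x.
Proof.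
have [[n _ /spikeE ->]|/spike_out ->//] := pselect ((\bigcup_n A n) x).
by rewrite exprn_ge0.
Qed.

Lemma measurable_spike : measurable_fun setT spike.
Proof.
apply: (measurable_restrictT _ (bigcupT_measurable _ mA)).1.
apply/measurable_fun_bigcup => // n.
have cst_on x : x \in A n -> cst (4 ^+ n : R) x = 4 ^+ xget 0%N [set k | A k x].
  move=> /set_mem Anx /=; rewrite -(spikeE n x Anx) /spike patchT//.
  by apply/mem_set; exists n.
by apply: (eq_measurable_fun _ cst_on); exact: measurable_cst.
Qed.

Lemma integral_spike_exp n k :
  (\int[mu]_(x in A n) (spike x ^+ k)%:E = ((4 ^+ k / 32) ^+ n)%:E)%E.
Proof.
rewrite (eq_integral (cst ((4 ^+ n) ^+ k)%:E)) => [|x /set_mem /spikeE ->//].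
by rewrite integral_cst// muA -EFinM exprMn -!exprM mulnC.
Qed.

(** A geometric series of ratio [4 ^+ 2 / 32 = 1 / 2]. *)
Lemma integral_spike_sqr_lty : (\int[mu]_x (spike x ^+ 2)%:E < +oo)%E.
Proof.
have -> : (\int[mu]_x (spike x ^+ 2)%:E =
    \int[mu]_(x in \bigcup_n A n) (spike x ^+ 2)%:E)%E.
  rewrite [RHS]integral_mkcond; apply: eq_integral => x _; rewrite /patch.
  by case: ifPn => // /negP Ax; rewrite spike_out ?expr0n// => /mem_set.
rewrite ge0_integral_bigcup//; last 2 first.
- apply/measurable_EFinP; apply: measurable_funX.
  exact: measurable_funTS measurable_spike.
- by move=> x _; rewrite lee_fin sqr_ge0.
under eq_eseriesr do rewrite integral_spike_exp.
have z1 : `|4 ^+ 2 / 32 : R| < 1.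
  by rewrite ger0_norm// ltr_pdivrMr// mul1r -natrX ltr_nat.
have -> : (\sum_(0 <= i <oo) ((4 ^+ 2 / 32 : R) ^+ i)%:E =
   (limn (series (geometric 1 (4 ^+ 2 / 32 : R))))%:E)%E.
  rewrite -EFin_lim; last exact: is_cvg_geometric_series.
  congr (limn _); apply/funext => n /=.
  by rewrite sumEFin /series /=; congr EFin;
    apply: eq_bigr => i _; rewrite mul1r.
exact: ltry.
Qed.

(** The integral over [A n] alone is at least [(4 ^+ 3 / 32) ^+ n = 2 ^+ n]. *)
Lemma integral_ge_spike_cube_pinfty (D : set T) (f : T -> R) :
  (forall n, A n `<=` D) -> (forall x, D x -> 0 <= f x) ->
  (forall n x, A n x -> spike x ^+ 3 <= f x) ->
  (\int[mu]_(x in D) (f x)%:E = +oo)%E.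
Proof.
move=> AD f0 fs; apply/eqyP => r r0.
have [n rn] : exists n, r <= 2 ^+ n.
  exists (Num.bound r); apply: ltW.
  apply: lt_le_trans (archi_boundP (ltW r0)) _.
  by rewrite -natrX ler_nat ltnW// ltn_expl.
apply: (@le_trans _ _ (\int[mu]_(x in A n) (spike x ^+ 3)%:E)%E).
  rewrite integral_spike_exp lee_fin; apply: le_trans rn _.
  rewrite lerXn2r ?nnegrE// ler_pdivlMr// -natrX -natrM ler_nat//.
rewrite !(integral_mkcond (A n)) (integral_mkcond D).
apply: ge0_le_integral_any => x _; rewrite /patch.
  by case: ifPn => // _; rewrite lee_fin exprn_ge0// spike_ge0.
case: ifPn => [/set_mem Ax|_].
  by rewrite mem_set ?lee_fin; [exact: fs Ax|exact: AD Ax].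
by case: ifPn => // /set_mem Dx; rewrite lee_fin f0.
Qed.

End spikes.

(** * The unit ball and slabs in Euclidean space *)

Section euclidean_facts.
Context {R : realType} {d : nat}.
Implicit Types x y : d.-tuple R.

Lemma normr_coord_le_enorm x i : `|tnth x i| <= enorm x.
Proof.
rewrite -sqrtr_sqr ler_sqrt; last by apply: sumr_ge0 => j _; exact: sqr_ge0.
by rewrite (bigD1 i)//= lerDl; apply: sumr_ge0 => j _; exact: sqr_ge0.
Qed.

Lemma measurable_unit_ball : measurable (unit_ball R d).
Proof.
have mn : measurable_fun setT
    (fun x : d.-tuple R => \sum_(i < d) tnth x i ^+ 2).
  apply: measurable_sum => i; apply: measurable_funX; exact: measurable_tnth.
rewrite (_ : unit_ball R d =
    setT `&` (fun x => \sum_(i < d) tnth x i ^+ 2) @^-1` `]-oo, 1[).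
  exact: mn.
have enorm_lt1 x : (enorm x < 1) = (\sum_(i < d) tnth x i ^+ 2 < 1).
  by rewrite /enorm -[X in Num.sqrt _ < X]sqrtr1 ltr_sqrt.
by apply/seteqP; split => x; rewrite /unit_ball /= enorm_lt1 in_itv/= => // -[].
Qed.

Lemma measurable_box (I : 'I_d -> set R) : (forall i, measurable (I i)) ->
  measurable [set x : d.-tuple R | forall i, I i (tnth x i)].
Proof.
move=> mI; rewrite (_ : [set _ | _] = \bigcap_(i in [set: 'I_d])
    ((fun x => tnth x i) @^-1` I i)).
  apply: fin_bigcap_measurable => // i _.
  by rewrite -[X in measurable X]setTI; exact: measurable_tnth.
by apply/seteqP; split => x /= h i; [move=> _|]; exact: h.
Qed.

Lemma leb_unit_ball_lty : (leb d (unit_ball R d) < +oo)%E.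
Proof.
pose Q := fun _ : 'I_d => `[-1, 1]%classic : set R.
have mQ i : measurable (Q i) by exact: measurable_itv.
apply: (@le_lt_trans _ _ (leb d [set x | forall i, Q i (tnth x i)])).
  apply: le_measure; rewrite ?inE.
  - exact: measurable_unit_ball.
  - exact: measurable_box.
  - move=> x /= bx i; rewrite /Q /= in_itv /= -ler_norml.
    exact: le_trans (normr_coord_le_enorm x i) (ltW bx).
rewrite leb_box// ltey_eq; apply/orP; left.
elim/big_ind : _ => // [a b fa fb|i _]; first exact: fin_numM.
by rewrite /Q lebesgue_measure_itv/=; case: ifP.
Qed.

Variable i0 : 'I_d.

Definition slab (I : set R) : set (d.-tuple R) :=
  [set x | forall i, (if i == i0 then I else `[0, 1]%classic) (tnth x i)].

Lemma slabP I x : slab I x -> I (tnth x i0).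
Proof. by move=> /(_ i0); rewrite eqxx. Qed.

Lemma measurable_slab I : measurable I -> measurable (slab I).
Proof.
move=> mI; apply: (measurable_box (fun i => if i == i0 then I else _)) => i.
by case: ifP => _ //; exact: measurable_itv.
Qed.

Lemma leb_slab I : measurable I -> leb d (slab I) = lebesgue_measure I.
Proof.
move=> mI; rewrite /slab.
rewrite (@leb_box R d (fun i => if i == i0 then I else _)); last first.
  by move=> i; case: ifP => _ //; exact: measurable_itv.
rewrite (bigD1 i0)//= eqxx big1 ?mule1// => i /negbTE ->.
by rewrite lebesgue_measure_itv/= lte01 oppr0 adde0.
Qed.

End euclidean_facts.

(** * The datum and the test function *)

Section counterexample.
Context {R : realType} {d : nat}.
Variable i0 : 'I_d.
Implicit Types x y : d.-tuple R.

(** The offset 2 keeps all slabs at distance at least 1 from the unit ball, and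
the [n]-th slab lies in the strip between [n + 2] and [n + 3], which makes the
family disjoint. *)
Definition thin_slab n : set (d.-tuple R) :=
  slab i0 `[n%:R + 2, n%:R + 2 + 32^-1 ^+ n[.
Definition far_slab : set (d.-tuple R) := slab i0 `[-3, -2].

Lemma measurable_thin_slab n : measurable (thin_slab n).
Proof. by apply: measurable_slab; exact: measurable_itv. Qed.

Lemma measurable_far_slab : measurable far_slab.
Proof. by apply: measurable_slab; exact: measurable_itv. Qed.

Lemma leb_thin_slab n : leb d (thin_slab n) = (32^-1 ^+ n)%:E.
Proof.
rewrite leb_slab ?measurable_itv// lebesgue_measure_itv/= lte_fin ltrDl.
rewrite exprn_gt0 ?invr_gt0//.
by rewrite -EFinB addrC addKr.
Qed.

Lemma leb_far_slab : leb d far_slab = 1%:E.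
Proof.
rewrite leb_slab ?measurable_itv// lebesgue_measure_itv/= lte_fin ltrN2.
rewrite ltr_nat/= -EFinB.
by congr EFin; rewrite opprK addrC -natrB.
Qed.

Lemma thin_slab_coord n x :
  thin_slab n x -> n%:R + 2 <= tnth x i0 < n.+1%:R + 2.
Proof.
move=> /slabP; rewrite /= in_itv/= => /andP[-> /lt_le_trans]; apply.
rewrite -[n.+1%:R]natr1 addrAC lerD2r lerD2l exprn_ile1// invf_le1//.
by rewrite ler1n.
Qed.

Lemma trivIset_thin_slab : trivIset setT thin_slab.
Proof.
apply/trivIsetP => m n _ _; wlog mn : m n / (m < n)%N => [H|_].
  by rewrite neq_lt => /orP[] mn; [|rewrite setIC]; apply: H => //;
    rewrite ?ltn_eqF // gtn_eqF.
apply/seteqP; split => // x.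
move=> [/thin_slab_coord/andP[_ xm] /thin_slab_coord/andP[nx _]].
have := le_lt_trans nx xm.
by rewrite ltrD2r ltr_nat ltnS leqNgt mn.
Qed.

Definition slab_spike : d.-tuple R -> R := spike thin_slab.

Lemma slab_spike_coord x : slab_spike x != 0 -> 2 <= tnth x i0.
Proof.
have [[n _ Ax]|/spike_out] := pselect ((\bigcup_n thin_slab n) x); last first.
  by rewrite /slab_spike => ->; rewrite eqxx.
move=> _; have /andP[+ _] := thin_slab_coord _ _ Ax.
by apply: le_trans; rewrite lerDr.
Qed.

Lemma notin_unit_ball x : 1 <= `|tnth x i0| -> (~` unit_ball R d) x.
Proof.
move=> x1; rewrite /unit_ball/=; apply/negP; rewrite -leNgt.
exact: le_trans x1 (normr_coord_le_enorm x i0).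
Qed.

Lemma slab_spike_ball x : unit_ball R d x -> slab_spike x = 0.
Proof.
apply: contraPeq => /slab_spike_coord x2; apply: notin_unit_ball.
by rewrite ger0_norm ?(le_trans _ x2)// ler1n.
Qed.

Lemma nu_le1 (alpha : R) x y : 0 <= alpha ->
  unit_ball R d x -> slab_spike y != 0 -> nu alpha (vsub x y) <= 1.
Proof.
move=> alpha_ge0 bx /slab_spike_coord y2; rewrite /nu.
have e1 : 1 <= enorm (vsub x y).
  apply: le_trans (normr_coord_le_enorm _ i0); rewrite tnth_mktuple.
  have := le_lt_trans (normr_coord_le_enorm x i0) bx.
  rewrite ltr_norml => /andP[_ x1]; rewrite distrC ger0_norm; lra.
rewrite -[leRHS](powRr0 (enorm (vsub x y))); apply: ler_powR => //.
by rewrite oppr_le0 addr_ge0.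
Qed.

Definition spike_mass : R := fine (\int[leb d]_x (slab_spike x ^+ 2)%:E).

Lemma measurable_slab_spike : measurable_fun setT slab_spike.
Proof.
exact: (measurable_spike _ measurable_thin_slab trivIset_thin_slab).
Qed.

Lemma integral_slab_spike_sqr :
  (\int[leb d]_x (slab_spike x ^+ 2)%:E = spike_mass%:E)%E.
Proof.
rewrite /spike_mass fineK// ge0_fin_numE; last first.
  by apply: integral_ge0 => x _; rewrite lee_fin sqr_ge0.
exact: (integral_spike_sqr_lty _ _ measurable_thin_slab trivIset_thin_slab
  leb_thin_slab).
Qed.

(** Where [slab_spike x - slab_spike y] is nonzero for [x] in the ball, the
kernel is at most 1, so the inner integral is at most the integral of
[slab_spike ^+ 2], uniformly in [x]. *)
Lemma V_slab_spike (alpha : R) :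
  0 <= alpha -> V (unit_ball R d) (nu alpha) slab_spike.
Proof.
move=> alpha_ge0; split; first exact: measurable_slab_spike.
- split; first exact: measurable_funTS measurable_slab_spike.
  rewrite (eq_integral (cst 0%E)) ?integral0 ?ltry// => x /set_mem bx.
  by rewrite /= slab_spike_ball// expr0n mul0r.
apply: (@le_lt_trans _ _
    (\int[leb d]_(x in unit_ball R d) (cst spike_mass%:E) x)%E).
  apply: ge0_le_integral_any => x bx.
    by apply: integral_ge0 => y _; rewrite lee_fin mulr_ge0 ?sqr_ge0 ?powR_ge0.
  rewrite /= -integral_slab_spike_sqr; apply: ge0_le_integral_any => y _.
    by rewrite lee_fin mulr_ge0 ?sqr_ge0 ?powR_ge0.
  rewrite lee_fin slab_spike_ball// sub0r sqrrN.
  have [->|vy] := eqVneq (slab_spike y) 0; first by rewrite expr0n mul0r.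
  by rewrite ler_piMr ?sqr_ge0// nu_le1.
rewrite integral_cst; last exact: measurable_unit_ball.
rewrite lte_mul_pinfty ?leb_unit_ball_lty//.
rewrite -integral_slab_spike_sqr; apply: integral_ge0 => y _.
by rewrite lee_fin sqr_ge0.
Qed.

(** Since [far_slab] has measure 1, the second term compensates exactly the mass
of the first one. *)
Definition spike_datum (y : d.-tuple R) : R :=
  slab_spike y ^+ 2 - spike_mass * \1_far_slab y.

Lemma spike_datum_thin_slab n y :
  thin_slab n y -> spike_datum y = slab_spike y ^+ 2.
Proof.
move=> Ay; rewrite /spike_datum indicE memNset ?mulr0 ?subr0// => /slabP.
rewrite /= in_itv/= => /andP[_ y2].
have /andP[y2' _] := thin_slab_coord _ _ Ay.
have n0 : 0 <= n%:R :> R by [].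
lra.
Qed.

Lemma spike_datum_ball y : unit_ball R d y -> spike_datum y = 0.
Proof.
move=> by1; rewrite /spike_datum slab_spike_ball// expr0n/= indicE.
rewrite memNset ?mulr0 ?subr0// => /slabP.
rewrite /= in_itv/= => /andP[_ y2]; apply: (notin_unit_ball y) by1.
rewrite ler0_norm; lra.
Qed.

Lemma integrable_slab_spike_sqr :
  (leb d).-integrable setT (fun y => (slab_spike y ^+ 2)%:E).
Proof.
apply/integrableP; split.
  apply/measurable_EFinP; apply: measurable_funX; exact: measurable_slab_spike.
under eq_integral do rewrite gee0_abs ?lee_fin ?sqr_ge0//.
by rewrite integral_slab_spike_sqr ltry.
Qed.

Lemma integrable_far_slab :
  (leb d).-integrable setT (fun y => (\1_far_slab y)%:E).
Proof.
apply/integrableP; split.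
  apply/measurable_EFinP; apply: measurable_indic.
  exact: measurable_far_slab.
under eq_integral do rewrite gee0_abs ?lee_fin//.
rewrite integral_indic//; last exact: measurable_far_slab.
by rewrite setIT [ltLHS]leb_far_slab ltry.
Qed.

Lemma integrable_scaled_far_slab :
  (leb d).-integrable setT (fun y => (spike_mass * \1_far_slab y)%:E).
Proof.
under eq_fun do rewrite EFinM.
by apply: integrableZl => //; exact: integrable_far_slab.
Qed.

Lemma integrable_spike_datum :
  (leb d).-integrable setT (fun y => (spike_datum y)%:E).
Proof.
rewrite (_ : (fun y => _) = (fun y =>
    (slab_spike y ^+ 2)%:E - (spike_mass * \1_far_slab y)%:E)%E).
  apply: integrableB => //; first exact: integrable_slab_spike_sqr.
  exact: integrable_scaled_far_slab.
by apply/funext => y; rewrite /spike_datum EFinB.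
Qed.

Lemma integral_spike_datum :
  (\int[leb d]_(y in ~` unit_ball R d) (spike_datum y)%:E = 0)%E.
Proof.
have -> : (\int[leb d]_(y in ~` unit_ball R d) (spike_datum y)%:E =
    \int[leb d]_y (spike_datum y)%:E)%E.
  rewrite [LHS]integral_mkcond; apply: eq_integral => y _; rewrite /patch.
  case: ifPn => // /negP yb; rewrite spike_datum_ball//.
  by apply: contrapT => /mem_set.
under eq_integral do rewrite EFinB.
rewrite integralB_EFin//; last 2 first.
- exact: integrable_slab_spike_sqr.
- exact: integrable_scaled_far_slab.
rewrite integral_slab_spike_sqr; under eq_integral do rewrite EFinM.
rewrite integralZl//; last exact: integrable_far_slab.
rewrite integral_indic//; last exact: measurable_far_slab.
by rewrite setIT [X in (_ * X)%E]leb_far_slab mule1 subee.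
Qed.

Lemma thin_slab_subset n : thin_slab n `<=` ~` unit_ball R d.
Proof.
move=> y /thin_slab_coord/andP[ny _]; apply: notin_unit_ball.
have n0 : 0 <= n%:R :> R by [].
rewrite ger0_norm; lra.
Qed.

Lemma not_in_L2_spike_datum (alpha : R) : 0 <= alpha ->
  ~ in_L2 (~` unit_ball R d) (fun x => (nutilde alpha x)^-1) spike_datum.
Proof.
move=> alpha_ge0 [_].
rewrite (integral_ge_spike_cube_pinfty _ _ measurable_thin_slab
  trivIset_thin_slab leb_thin_slab)// => [n|x _|n x Ax].
- exact: thin_slab_subset.
- by rewrite mulr_ge0 ?sqr_ge0// invr_ge0 powR_ge0.
rewrite (spike_datum_thin_slab n)// -exprM /slab_spike.
rewrite (spikeE _ trivIset_thin_slab n)//.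
rewrite /nutilde powRN invrK.
have w1 : 1 <= (1 + enorm x) `^ (d%:R + alpha).
  rewrite -[leLHS](powRr0 (1 + enorm x)); apply: ler_powR.
    by rewrite lerDl sqrtr_ge0.
  by rewrite addr_ge0.
apply: le_trans (ler_peMr _ w1); last by rewrite !exprn_ge0.
by rewrite ler_weXn2l// exprn_ege1// ler1n.
Qed.

Lemma not_integrable_spike_datum_spike :
  ~ (leb d).-integrable (~` unit_ball R d)
    (fun y => (spike_datum y * slab_spike y)%:E).
Proof.
move=> /integrableP[_]; under eq_integral do rewrite abse_EFin.
rewrite (integral_ge_spike_cube_pinfty _ _ measurable_thin_slab
  trivIset_thin_slab leb_thin_slab)// => [n|n x Ax].
  exact: thin_slab_subset.
by rewrite (spike_datum_thin_slab n)// -exprSr ler_norm.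
Qed.

End counterexample.

Theorem theorem4p13 (R : realType) (d : nat) (hd : (0 < d)%N) (alpha : R)
    (halpha0 : 0 < alpha) (halpha2 : alpha < 2) :
  exists g : d.-tuple R -> R,
    [/\ (leb d).-integrable (~` unit_ball R d) (fun y => (g y)%:E),
        ~ in_L2 (~` unit_ball R d) (fun x => (nutilde alpha x)^-1) g,
        (\int[leb d]_(y in ~` unit_ball R d) (g y)%:E)%E = 0%E &
        ~ exists u : d.-tuple R -> R,
            weak_solution (unit_ball R d) (nu alpha) g u].
Proof.
have alpha_ge0 := ltW halpha0.
exists (spike_datum (Ordinal hd)); split.
- apply: integrableS (integrable_spike_datum _) => //; apply: measurableC.
  exact: measurable_unit_ball.
- exact: not_in_L2_spike_datum alpha_ge0.
- exact: integral_spike_datum.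
move=> [u [_ /(_ _ (V_slab_spike (Ordinal hd) alpha alpha_ge0))[+ _]]].
exact: not_integrable_spike_datum_spike.
Qed.
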